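(* Let $\omega\in[0,1]$ and let $A\in\mathbb{C}^{m\times m}$, $B\in\mathbb{C}^{m\times n}$, $C\in\mathbb{C}^{n\times m}$, $D\in\mathbb{C}^{n\times n}$ be such that $XCX-XD-AX+B=0$ is in class $\mathbb{H}^\omega$, and suppose that $Q_\omega\mathbf{1}>0$, where $Q=\begin{pmatrix}D&-C\\-B&A\end{pmatrix}$. Let $\Phi$ and $\Psi$ be the extremal solutions of $XCX-XD-AX+B=0$ and of its dual $YBY-YA-DY+C=0$, respectively. Apply ADDA to $XCX-XD-AX+B=0$ with $\alpha=tz_\omega^\bot$ and $\beta=\gamma z_\omega^\bot$, where $z_\omega^\bot=\omega+\mathrm{j}(1-\omega)$. If $$t\ge\psi_1:=\max_{i=n+1,\dots,m+n}\frac{p_{\omega,i}}{\varpi},\qquad \gamma\ge\psi_2:=\max_{i=1,\dots,n}\frac{p_{\omega,i}}{\varpi},$$ then the sequences $\{E_k\},\{F_k\},\{H_k\},\{G_k\}$ are well-defined and $\{H_k\}$ and $\{G_k\}$ converge quadratically to $\Phi$ and $\Psi$, respectively.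
   Context: For a complex square matrix $M$ and a real $\omega\in[0,1]$, the $\omega$-comparison matrix $M_\omega$ is the real matrix with entries $[M_\omega]_{ii}=\omega\,\mathrm{Re}([M]_{ii})+(1-\omega)\,\mathrm{Im}([M]_{ii})$ and $[M_\omega]_{ij}=-|[M]_{ij}|$ for $i\ne j$. A real square matrix $M$ is a nonsingular M-matrix if all its off-diagonal entries are nonpositive and $Mu>0$ (entrywise) for some vector $u>0$. $\mathbf{1}$ is the all-ones column vector; $\mathrm{j}$ is the imaginary unit. The equation is in class $\mathbb{H}^\omega$ if $Q_\omega$ is a nonsingular M-matrix. Notation: $\varpi=\omega^2+(1-\omega)^2$, $q_i=\sum_{j\ne i}|[Q]_{ij}|$, and for $i=1,\dots,m+n$ $$p_{\omega,i}=\frac{\omega\mathrm{Re}([Q]_{ii})+(1-\omega)\mathrm{Im}([Q]_{ii})+q_i}{2}+\frac{(\omega\mathrm{Im}([Q]_{ii})-(1-\omega)\mathrm{Re}([Q]_{ii}))^2}{2(\omega\mathrm{Re}([Q]_{ii})+(1-\omega)\mathrm{Im}([Q]_{ii})-q_i)}.$$ Extremal solutions: $\Phi$ is the unique solution of $XCX-XD-AX+B=0$ such that every eigenvalue $\lambda$ of $D-C\Phi$ satisfies $\omega\,\mathrm{Re}(\lambda)+(1-\omega)\,\mathrm{Im}(\lambda)>0$; $\Psi$ is the unique solution of $YBY-YA-DY+C=0$ such that every eigenvalue $\lambda$ of $A-B\Psi$ satisfies the same inequality (both exist and are unique under these hypotheses). ADDA with parameters $\alpha,\beta$: put $A_\beta=A+\beta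 I$, $D_\alpha=D+\alpha I$, $W_{\alpha\beta}=A_\beta-BD_\alpha^{-1}C$, $V_{\alpha\beta}=D_\alpha-CA_\beta^{-1}B$, and $$E_0=I-(\alpha+\beta)V_{\alpha\beta}^{-1},\ F_0=I-(\alpha+\beta)W_{\alpha\beta}^{-1},\ G_0=(\alpha+\beta)D_\alpha^{-1}CW_{\alpha\beta}^{-1},\ H_0=(\alpha+\beta)W_{\alpha\beta}^{-1}BD_\alpha^{-1};$$ for $k\ge0$, $$E_{k+1}=E_k(I-G_kH_k)^{-1}E_k,\quad F_{k+1}=F_k(I-H_kG_k)^{-1}F_k,$$ $$G_{k+1}=G_k+E_k(I-G_kH_k)^{-1}G_kF_k,\quad H_{k+1}=H_k+F_k(I-H_kG_k)^{-1}H_kE_k.$$ ''Well-defined'' means all inverses involved exist. Quadratic convergence of the doubling algorithm means $\limsup_{k\to\infty}\|H_k-\Phi\|^{1/2^k}<1$ and $\limsup_{k\to\infty}\|G_k-\Psi\|^{1/2^k}<1$. *)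

(* Defs.v *)
From HB Require Import structures.
From mathcomp Require Import all_boot all_order all_algebra.
From mathcomp Require Import all_classical all_reals all_analysis.
From mathcomp Require Import complex.

Set Implicit Arguments.
Unset Strict Implicit.
Unset Printing Implicit Defensive.

Import Order.TTheory GRing.Theory Num.Theory.

Local Open Scope ring_scope.

Section OmegaComparison.
Variable R : realType.
Implicit Types w : R.

Definition cmod (z : R[i]) : R := complex.Re `|z|.

Definition omega_part w (z : R[i]) : R :=
  w * complex.Re z + (1 - w) * complex.Im z.

Definition z_bot w : R[i] := Complex w (1 - w).

Definition omega_comparison w k (M : 'M[R[i]]_k) : 'M[R]_k :=
  \matrix_(i, j) if i == j then omega_part w (M i i) else - cmod (M i j).

Definition positive_cV k (u : 'cV[R]_k) : Prop := forall i, 0 < u i 0.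

Definition nonsingular_M_matrix k (M : 'M[R]_k) : Prop :=
  (forall i j, i != j -> M i j <= 0) /\
  (exists u : 'cV[R]_k, positive_cV u /\ positive_cV (M *m u)).

Definition varpi w : R := w ^+ 2 + (1 - w) ^+ 2.

Definition offdiag_sum k (M : 'M[R[i]]_k) (i : 'I_k) : R :=
  \sum_(j < k | j != i) cmod (M i j).

Definition p_omega w k (M : 'M[R[i]]_k) (i : 'I_k) : R :=
  (omega_part w (M i i) + offdiag_sum M i) / 2 +
  (w * complex.Im (M i i) - (1 - w) * complex.Re (M i i)) ^+ 2 /
    (2 * (omega_part w (M i i) - offdiag_sum M i)).

Definition ord_maximum k (f : 'I_k.+1 -> R) : R :=
  \big[Num.max/f ord0]_(i < k.+1) f i.

End OmegaComparison.

Section Riccati.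
Variables (R : realType) (m n : nat).
Variables (A : 'M[R[i]]_m) (B : 'M[R[i]]_(m, n)).
Variables (C : 'M[R[i]]_(n, m)) (D : 'M[R[i]]_n).

Definition riccati_Q : 'M[R[i]]_(n + m) := block_mx D (- C) (- B) A.

Definition class_H (w : R) : Prop :=
  nonsingular_M_matrix (omega_comparison w riccati_Q).

(* The dual equation Y B Y - Y A - D Y + C = 0, with spectral condition on
   A - B Y, is the instance with (A, B, C, D) replaced by (D, C, B, A). *)
Definition extremal_solution (w : R) (X : 'M[R[i]]_(m, n)) : Prop :=
  X *m C *m X - X *m D - A *m X + B = 0 /\
  (forall l : R[i], eigenvalue (D - C *m X) l -> 0 < omega_part w l).

Record adda_state := AddaState {
  adda_E : 'M[R[i]]_n;
  adda_F : 'M[R[i]]_m;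
  adda_G : 'M[R[i]]_(n, m);
  adda_H : 'M[R[i]]_(m, n) }.

Variables (alpha beta : R[i]).

Definition adda_A : 'M[R[i]]_m := A + beta%:M.
Definition adda_D : 'M[R[i]]_n := D + alpha%:M.
Definition adda_W : 'M[R[i]]_m := adda_A - B *m invmx adda_D *m C.
Definition adda_V : 'M[R[i]]_n := adda_D - C *m invmx adda_A *m B.

Definition adda_init : adda_state := {|
  adda_E := 1%:M - (alpha + beta) *: invmx adda_V;
  adda_F := 1%:M - (alpha + beta) *: invmx adda_W;
  adda_G := (alpha + beta) *: (invmx adda_D *m C *m invmx adda_W);
  adda_H := (alpha + beta) *: (invmx adda_W *m B *m invmx adda_D) |}.

Definition adda_step (s : adda_state) : adda_state :=
  let: AddaState E F G H := s in
  let IGH := invmx (1%:M - G *m H) in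
  let IHG := invmx (1%:M - H *m G) in
  {| adda_E := E *m IGH *m E;
     adda_F := F *m IHG *m F;
     adda_G := G + E *m IGH *m G *m F;
     adda_H := H + F *m IHG *m H *m E |}.

Definition adda (k : nat) : adda_state := iter k adda_step adda_init.

(* [invmx] is total, so the existence of every inverse occurring in the
   recursion has to be required explicitly. *)
Definition adda_well_defined : Prop :=
  [/\ adda_A \in unitmx, adda_D \in unitmx,
      adda_W \in unitmx, adda_V \in unitmx &
      forall k, 1%:M - adda_G (adda k) *m adda_H (adda k) \in unitmx /\
                1%:M - adda_H (adda k) *m adda_G (adda k) \in unitmx].

End Riccati.

(* [mx_norm] is the entrywise maximum norm, here with values in the nonnegative
   reals of R[i].  The limsup does not depend on the norm, as the 2^k-th roots
   of the equivalence constants tend to 1. *)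
Definition doubling_quadratic_cvg (R : realType) (m n : nat)
    (X : nat -> 'M[R[i]]_(m, n)) (L : 'M[R[i]]_(m, n)) : Prop :=
  (limn_esup (fun k => (complex.Re (mx_norm (X k - L)) `^ (2 ^- k))%:E) < 1%E)%E.

(* Main.v *)
Require Import Defs.
From mathcomp Require Import all_boot all_order all_algebra.
From mathcomp Require Import all_classical all_reals all_analysis.
From mathcomp Require Import complex.
From mathcomp Require Import ring lra.

(** A sup-norm argument proves everything.

    In the variables [x], [x'], [y], [y'], the initial ADDA matrices express
    the Cayley transform of [[D, -C; B, -A]] as a scattering operator
    [(x, y') |-> (x', y) = (E x + G y', H x + F y')], which solves the
    implicit equations [cayley_relation].  A doubling step composes two such
    operators, the inner outputs [x'] and [y'] being matched
    ([scatters_step], [adda_step_split]).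

    Put [a = |alpha|] and [b = |beta|].  The hypothesis [Q_w 1 > 0] makes
    every row of [(D, C)], with off-diagonal sum [q], satisfy
    [|alpha| + delta + q <= |D_ii + alpha|].  The lower bound on [gamma] says
    that the disc of radius [q] about [D_ii] times the conjugate of [z_bot w]
    lies in the disc of centre and radius [gamma * varpi w], whence
    [|D_ii - beta| + q <= |beta|].  The rows of [(A, B)] behave likewise, with
    [alpha] and [beta] exchanged.  Reading the implicit equations at a row
    where the output is largest gives a contraction for weighted norms:
    [|x| <= a u] and [|y'| <= b u] imply [|x'| <= rho b u] and
    [|y| <= rho a u], with [rho = (a + b) / (a + b + delta) < 1]
    ([cayley_contraction]).  Composition keeps [rho] and squares both weights
    ([contractive_step]).  A contractive operator has [I - GH] and [I - HG]
    invertible, so the recursion never breaks down.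

    The graph of [Phi] is invariant: with [M = D - C Phi] and
    [T = (M + alpha)^-1 (M - beta)], the data [(1, T, Phi, Phi T)] solve the
    implicit equations.  At stage [k] this reads
    [Phi = H_k + F_k Phi T^(2^k)].  The contraction bounds [F_k] by
    [rho (a / b)^(2^k)], and bounds [T] by [rho b / a] once [Phi] is
    nonexpansive, so the error is at most [rho^(2^k)].

    The spectral condition makes [M + alpha] invertible and an extremal
    solution nonexpansive ([graph_nonexpansive]).  For the latter, take equal parameters
    [tau = max t gamma], for which both weights agree and the eigenvalues of
    [T] lie in the open unit disc.  If [|Phi x| > |x|], the contraction makes
    [|Phi T^k x|] nondecreasing in [k], although [T^k x] tends to [0].

    The statements on [Psi] and [G_k] are those on [Phi] and [H_k] after
    exchanging [A] with [D], [B] with [C] and [alpha] with [beta]. *)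

Set Implicit Arguments.
Unset Strict Implicit.
Unset Printing Implicit Defensive.

Import Order.TTheory GRing.Theory Num.Theory numFieldNormedType.Exports.
Local Open Scope ring_scope.

(** * The modulus of a complex number *)

Section Modulus.
Variable R : realType.
Implicit Types z : R[i].

Lemma normE_cmod z : `|z| = (cmod z)%:C%C.
Proof. by rewrite /cmod normc_def. Qed.

Lemma cmod_ge0 z : 0 <= cmod z.
Proof. by rewrite /cmod normc_def sqrtr_ge0. Qed.

Lemma cmod0 : cmod (0 : R[i]) = 0.
Proof. by rewrite /cmod normr0. Qed.

Lemma cmod0_eq0 z : cmod z = 0 -> z = 0.
Proof. by move=> z0; apply/normr0_eq0; rewrite normE_cmod z0. Qed.

Lemma cmodN z : cmod (- z) = cmod z.
Proof. by rewrite /cmod normrN. Qed.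

Lemma cmodM z1 z2 : cmod (z1 * z2) = cmod z1 * cmod z2.
Proof. by rewrite /cmod normrM !normE_cmod -rmorphM. Qed.

Lemma cmodD z1 z2 : cmod (z1 + z2) <= cmod z1 + cmod z2.
Proof. by have := ler_normD z1 z2; rewrite !normE_cmod -rmorphD lecR. Qed.

Lemma cmod_sum (I : Type) (r : seq I) (P : pred I) (F : I -> R[i]) :
  cmod (\sum_(i <- r | P i) F i) <= \sum_(i <- r | P i) cmod (F i).
Proof.
elim/big_rec2: _ => [|i x z _ le_zx]; first by rewrite cmod0.
by apply: le_trans (cmodD _ _) _; rewrite lerD2l.
Qed.

Lemma cmodE (x y : R) : cmod (Complex x y) = Num.sqrt (x ^+ 2 + y ^+ 2).
Proof. by rewrite /cmod normc_def. Qed.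

End Modulus.

(** * The sup norm of a column vector *)

Section SupNorm.
Variable R : realType.

Definition supn n (x : 'cV[R[i]]_n) : R := \big[Num.max/0]_i cmod (x i 0).

Lemma supn_ge0 n (x : 'cV_n) : 0 <= supn x.
Proof. exact: bigmax_ge_id. Qed.

Lemma cmod_le_supn n (x : 'cV_n) i : cmod (x i 0) <= supn x.
Proof. exact: le_bigmax. Qed.

Lemma supn_le n (x : 'cV_n) u :
  0 <= u -> (forall i, cmod (x i 0) <= u) -> supn x <= u.
Proof. by move=> u0 xu; apply: bigmax_le => // i _; exact: xu. Qed.

(** The index attaining the norm is what diagonal dominance is applied to. *)
Lemma supn_cases n (x : 'cV_n) : supn x = 0 \/ exists i, supn x = cmod (x i 0).
Proof.
rewrite /supn.
elim/big_ind: _ => [|a b [->|[i ->]] [->|[j ->]]|i _]; first by left.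
- by left; rewrite maxxx.
- by right; exists j; rewrite max_r// cmod_ge0.
- by right; exists i; rewrite max_l// cmod_ge0.
- by right; case: leP => _; [exists j|exists i].
- by right; exists i.
Qed.

Lemma supn0 n : supn (0 : 'cV_n) = 0.
Proof.
by apply: le_anti; rewrite supn_ge0 supn_le// => i; rewrite mxE cmod0.
Qed.

Lemma supn_eq0 n (x : 'cV_n) : supn x <= 0 -> x = 0.
Proof.
move=> x0; apply/colP => i; rewrite mxE; apply: cmod0_eq0.
by apply: le_anti; rewrite cmod_ge0 (le_trans (cmod_le_supn x i)).
Qed.

Lemma supnD n (x y : 'cV_n) : supn (x + y) <= supn x + supn y.
Proof.
apply: supn_le => [|i]; first by rewrite addr_ge0 ?supn_ge0.
by rewrite mxE (le_trans (cmodD _ _))// lerD ?cmod_le_supn.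
Qed.

Lemma supnZ n (l : R[i]) (x : 'cV_n) : supn (l *: x) <= cmod l * supn x.
Proof.
apply: supn_le => [|i]; first by rewrite mulr_ge0 ?cmod_ge0 ?supn_ge0.
by rewrite mxE cmodM ler_wpM2l ?cmod_ge0 ?cmod_le_supn.
Qed.

Lemma supn_mulmx m n (M : 'M[R[i]]_(m, n)) :
  exists2 K, 0 <= K & forall x, supn (M *m x) <= K * supn x.
Proof.
exists (\sum_i \sum_j cmod (M i j)).
  by apply: sumr_ge0 => i _; apply: sumr_ge0 => j _; exact: cmod_ge0.
move=> x; apply: supn_le => [|i].
  rewrite mulr_ge0 ?supn_ge0 ?sumr_ge0// => i _.
  by rewrite sumr_ge0// => j _; exact: cmod_ge0.
rewrite mxE (bigD1 i)//= mulrDl ler_wpDr//.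
  rewrite mulr_ge0 ?supn_ge0 ?sumr_ge0// => k _.
  by rewrite sumr_ge0// => j _; exact: cmod_ge0.
apply: le_trans (cmod_sum _ _ _) _; rewrite mulr_suml ler_sum// => j _.
by rewrite cmodM ler_wpM2l ?cmod_ge0 ?cmod_le_supn.
Qed.

Lemma unitmx_inj n (M : 'M[R[i]]_n) :
  (forall x : 'cV_n, M *m x = 0 -> x = 0) -> M \in unitmx.
Proof.
move=> injM; rewrite -unitmx_tr -row_free_unit -kermx_eq0.
apply/eqP/row_matrixP => i; rewrite row0; apply: trmx_inj; rewrite trmx0.
apply: injM; apply: trmx_inj.
by rewrite trmx_mul trmxK trmx0; apply/sub_kermxP; exact: row_sub.
Qed.

End SupNorm.

(** * Diagonal dominance makes the implicit equations contract *)

Section RowGap.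
Variable R : realType.

(** The two properties of a block row [(D, C)] that the proof uses.  With [q]
    the absolute sum of the row outside its diagonal entry, [D_ii] is far from
    [- alpha] by strict dominance, and the disc of centre [D_ii] and radius
    [q] is contained in the disc of centre [beta] through the origin. *)
Definition row_gap m n (D : 'M[R[i]]_n) (C : 'M[R[i]]_(n, m))
    (alpha beta : R[i]) (delta : R) : Prop :=
  forall i, let q := offdiag_sum D i + \sum_j cmod (C i j) in
    cmod alpha + delta + q <= cmod (D i i + alpha) /\
    cmod (D i i - beta) + q <= cmod beta.

(** The contraction factor is symmetric in the two parameters, so one value
    serves both block rows. *)
Definition rate (alpha beta : R[i]) (delta : R) : R :=
  (cmod alpha + cmod beta) / (cmod alpha + cmod beta + delta).

Lemma offdiag_sum_ge0 n (D : 'M[R[i]]_n) i : 0 <= offdiag_sum D i.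
Proof. by apply: sumr_ge0 => j _; exact: cmod_ge0. Qed.

Lemma cmod_mulmx_row m n (C : 'M[R[i]]_(n, m)) (y : 'cV_m) i v :
  supn y <= v -> cmod ((C *m y) i 0) <= (\sum_j cmod (C i j)) * v.
Proof.
move=> yv; rewrite mxE (le_trans (cmod_sum _ _ _))// mulr_suml ler_sum// => j _.
rewrite cmodM ler_wpM2l ?cmod_ge0//; exact: le_trans (cmod_le_supn _ _) yv.
Qed.

Lemma mulmx_diag_row n (D : 'M[R[i]]_n) (x : 'cV_n) i :
  exists2 r, (D *m x) i 0 = D i i * x i 0 + r
           & forall v, supn x <= v -> cmod r <= offdiag_sum D i * v.
Proof.
exists (\sum_(j | j != i) D i j * x j 0); first by rewrite mxE (bigD1 i).
move=> v xv; rewrite (le_trans (cmod_sum _ _ _))// mulr_suml ler_sum// => j _.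
rewrite cmodM ler_wpM2l ?cmod_ge0//; exact: le_trans (cmod_le_supn _ _) xv.
Qed.

(** Moving the terms in [y] and [y'] across, these equations say
    [(K + alpha) (x', y') = (K - beta) (x, y)] for [K = [D, -C; B, -A]].
    This form, with [x'] and [y] on the left, keeps the diagonally dominant
    blocks [D + alpha] and [A + beta] on the diagonal. *)
Definition cayley_relation m n p (A : 'M[R[i]]_m) (B : 'M[R[i]]_(m, n))
    (C : 'M[R[i]]_(n, m)) (D : 'M[R[i]]_n) (alpha beta : R[i])
    (x x' : 'M[R[i]]_(n, p)) (y y' : 'M[R[i]]_(m, p)) : Prop :=
  (D + alpha%:M) *m x' + C *m y = (D - beta%:M) *m x + C *m y' /\
  B *m x' + (A + beta%:M) *m y = B *m x + (A - alpha%:M) *m y'.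

Lemma cayley_relation_mulmxr m n p q (A : 'M[R[i]]_m) (B : 'M[R[i]]_(m, n))
    (C : 'M[R[i]]_(n, m)) (D : 'M[R[i]]_n) (alpha beta : R[i])
    (x x' : 'M[R[i]]_(n, p)) (y y' : 'M[R[i]]_(m, p)) (z : 'M[R[i]]_(p, q)) :
  cayley_relation A B C D alpha beta x x' y y' ->
  cayley_relation A B C D alpha beta (x *m z) (x' *m z) (y *m z) (y' *m z).
Proof. by case=> e1 e2; split; rewrite !mulmxA -!mulmxDl ?e1 ?e2. Qed.

(** Row [i] of the first equation, at an index where the output [x'] attains
    the weighted bound [cmod beta * v].  Write [a], [b] for the moduli of the
    parameters and [qC] for the absolute row sum of [C].  The weights are
    chosen so that [row_gap] gives [v * (K + b * delta) <= u * K] with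
    [K = a * b + (b - a) * qC]. *)
Lemma row_gap_peak m n (D : 'M[R[i]]_n) (C : 'M[R[i]]_(n, m)) alpha beta delta
    (x x' : 'cV_n) (y y' : 'cV_m) (u v : R) i :
    row_gap D C alpha beta delta ->
    0 < delta -> 0 < cmod alpha -> 0 < cmod beta ->
    0 <= u -> 0 <= v ->
    (D + alpha%:M) *m x' + C *m y = (D - beta%:M) *m x + C *m y' ->
    supn x <= cmod alpha * u -> supn y' <= cmod beta * u ->
    supn y <= cmod alpha * v -> supn x' <= cmod beta * v ->
    cmod (x' i 0) = cmod beta * v ->
  v <= rate alpha beta delta * u.
Proof.
move=> /(_ i)[]; set a := cmod alpha; set b := cmod beta.
set qD := offdiag_sum D i; set qC := \sum_j _ => gapa gapb d0 a0 b0 u0 v0.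
move=> /colP/(_ i) eqi xu y'u yv x'v peak.
have [r' Dx' r'v] := mulmx_diag_row D x' i.
have [r Dx ru] := mulmx_diag_row D x i.
have addE p (M N : 'cV[R[i]]_p) k : (M + N) k 0 = M k 0 + N k 0 by rewrite mxE.
have oppE p (M : 'cV[R[i]]_p) k : (- M) k 0 = - M k 0 by rewrite mxE.
have scaleE p l (M : 'cV[R[i]]_p) k : (l *: M) k 0 = l * M k 0 by rewrite mxE.
move: eqi; rewrite mulmxDl mulmxBl !mul_scalar_mx.
rewrite !addE oppE !scaleE Dx' Dx => eqi.
have {}eqi : (D i i + alpha) * x' i 0 =
    (D i i - beta) * x i 0 + r + (C *m y') i 0 + (- r') + (- (C *m y) i 0).
  apply/eqP; rewrite -subr_eq0; apply/eqP.
  by move/eqP: eqi; rewrite -subr_eq0 => /eqP <-; ring.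
have qD0 : 0 <= qD := offdiag_sum_ge0 D i.
have qC0 : 0 <= qC by apply: sumr_ge0 => j _; exact: cmod_ge0.
have main : cmod (D i i + alpha) * (b * v) <=
    cmod (D i i - beta) * (a * u) + qD * (a * u) + qC * (b * u)
    + qD * (b * v) + qC * (a * v).
  rewrite -{1}peak -cmodM eqi.
  apply: le_trans (cmodD _ _) _; apply: lerD;
    last by rewrite cmodN; exact: cmod_mulmx_row.
  apply: le_trans (cmodD _ _) _; apply: lerD; last by rewrite cmodN; exact: r'v.
  apply: le_trans (cmodD _ _) _; apply: lerD; last exact: cmod_mulmx_row.
  apply: le_trans (cmodD _ _) _; apply: lerD; last exact: ru.
  rewrite cmodM ler_wpM2l ?cmod_ge0//; exact: le_trans (cmod_le_supn _ _) xu.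
have Kge : 0 <= a * b + (b - a) * qC.
  have : 0 <= cmod (D i i - beta) by exact: cmod_ge0.
  nra.
have step :
    v * (a * b + (b - a) * qC + b * delta) <= u * (a * b + (b - a) * qC).
  have h1 : (a + delta + (qD + qC)) * (b * v) <= cmod (D i i + alpha) * (b * v).
    by rewrite ler_wpM2r// mulr_ge0// ltW.
  have h2 : cmod (D i i - beta) * (a * u) <= (b - (qD + qC)) * (a * u).
    by apply: ler_wpM2r; [rewrite mulr_ge0// ltW|lra].
  lra.
rewrite /rate -/a -/b mulrAC ler_pdivlMr; last lra.
set K := a * b + (b - a) * qC in Kge step.
have qCb : qC <= b by have : 0 <= cmod (D i i - beta) := cmod_ge0 _; lra.
(* [K / (K + b * delta)] grows with [K], which is at most [b * (a + b)]. *)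
have Kle : K <= b * (a + b) by rewrite /K; nra.
have K1 : 0 < K + b * delta by nra.
rewrite -(ler_pM2r K1).
have : v * (K + b * delta) * (a + b + delta) <= u * K * (a + b + delta).
  by rewrite ler_wpM2r//; lra.
have : u * (delta * K) <= u * (delta * (b * (a + b))).
  by rewrite ler_wpM2l// ler_wpM2l// ltW.
lra.
Qed.

Lemma rate_bounds alpha beta delta : 0 < cmod alpha -> 0 < cmod beta ->
  0 < delta -> 0 <= rate alpha beta delta < 1.
Proof.
move=> a0 b0 d0; have s0 : 0 < cmod alpha + cmod beta + delta by lra.
by rewrite /rate divr_ge0 ?ltr_pdivrMr//; lra.
Qed.

(** The larger of the two weighted outputs is attained in one of the block
    rows.  The second row is the first one after exchanging [A] with [D], [B]
    with [C], [alpha] with [beta], [x] with [y'] and [x'] with [y], and the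
    weights are invariant under this exchange. *)
Lemma cayley_contraction m n (A : 'M[R[i]]_m) (B : 'M[R[i]]_(m, n))
    (C : 'M[R[i]]_(n, m)) (D : 'M[R[i]]_n) (alpha beta : R[i]) delta
    (x x' : 'cV_n) (y y' : 'cV_m) (u : R) :
    row_gap D C alpha beta delta -> row_gap A B beta alpha delta ->
    0 < delta -> 0 < cmod alpha -> 0 < cmod beta ->
    cayley_relation A B C D alpha beta x x' y y' ->
    supn x <= cmod alpha * u -> supn y' <= cmod beta * u ->
  supn x' <= rate alpha beta delta * (cmod beta * u) /\
  supn y <= rate alpha beta delta * (cmod alpha * u).
Proof.
move=> gapD gapA d0 a0 b0 [eqD eqA] xu y'u.
have u0 : 0 <= u by have := le_trans (supn_ge0 x) xu; rewrite pmulr_rge0.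
pose v := Num.max (supn x' / cmod beta) (supn y / cmod alpha).
have x'v : supn x' <= cmod beta * v.
  by rewrite mulrC -ler_pdivrMr// /v le_max lexx.
have yv : supn y <= cmod alpha * v.
  by rewrite mulrC -ler_pdivrMr// /v le_max lexx orbT.
have v0 : 0 <= v by rewrite /v le_max divr_ge0 ?supn_ge0// ltW.
have /andP[r0 _] := rate_bounds a0 b0 d0.
suff vu : v <= rate alpha beta delta * u.
  split; [apply: le_trans x'v _|apply: le_trans yv _];
    by rewrite mulrCA ler_pM2l.
have [vx|vy] : v = supn x' / cmod beta \/ v = supn y / cmod alpha.
  by rewrite /v; case: leP; [right|left].
- have [x0|[i xi]] := supn_cases x'.
    by rewrite vx x0 mul0r mulr_ge0.
  apply: (row_gap_peak (i := i) gapD d0 a0 b0 u0 v0 eqD) => //.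
  by rewrite -xi vx mulrC divfK// gt_eqF.
- have [y0|[i yi]] := supn_cases y.
    by rewrite vy y0 mul0r mulr_ge0.
  rewrite /rate (addrC (cmod alpha)) -/(rate beta alpha delta).
  apply: (row_gap_peak (i := i) (x := y') (x' := y) (y := x') (y' := x)
    gapA d0 b0 a0 u0 v0) => //.
    by rewrite addrC eqA addrC.
  by rewrite -yi vy mulrC divfK// gt_eqF.
Qed.

End RowGap.

(** * Doubling as composition of scattering operators *)

Section Doubling.
Variables (R : realType) (m n : nat).
Implicit Types (s : adda_state R m n) (a b rho : R).

(** The matrices [E], [F], [G], [H] act as a two-port: [x] and [y'] enter,
    [x'] and [y] leave. *)
Definition scatters s p
    (x x' : 'M[R[i]]_(n, p)) (y y' : 'M[R[i]]_(m, p)) : Prop :=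
  x' = adda_E s *m x + adda_G s *m y' /\ y = adda_H s *m x + adda_F s *m y'.

Definition contractive rho a b s : Prop :=
  forall (x x' : 'cV[R[i]]_n) (y y' : 'cV[R[i]]_m) u,
    scatters s x x' y y' -> supn x <= a * u -> supn y' <= b * u ->
  supn x' <= rho * (b * u) /\ supn y <= rho * (a * u).

Definition step_defined s : Prop :=
  1%:M - adda_G s *m adda_H s \in unitmx /\
  1%:M - adda_H s *m adda_G s \in unitmx.

(** Feeding only [x] or only [y'] shows that [H] and [G] contract by [rho] for
    the plain sup norm, since the weights cancel. *)
Lemma contractive_step_defined rho a b s :
  0 <= rho < 1 -> 0 < a -> 0 < b -> contractive rho a b s -> step_defined s.
Proof.
move=> /andP[r0 r1] a0 b0 cs.
have boundG y : supn (adda_G s *m y) <= rho * supn y.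
  have := cs 0 (adda_G s *m y) (adda_F s *m y) y (supn y / b).
  rewrite /scatters !mulmx0 !add0r supn0 ![_ * (supn y / b)]mulrC divfK ?gt_eqF//.
  by case=> //; rewrite mulr_ge0// ?divr_ge0 ?supn_ge0// ltW.
have boundH x : supn (adda_H s *m x) <= rho * supn x.
  have := cs x (adda_E s *m x) (adda_H s *m x) 0 (supn x / a).
  rewrite /scatters !mulmx0 !addr0 supn0 ![_ * (supn x / a)]mulrC divfK ?gt_eqF//.
  by case=> //; rewrite mulr_ge0// ?divr_ge0 ?supn_ge0// ltW.
have strict p (z z' : 'cV[R[i]]_p) :
    supn z' <= rho * (rho * supn z) -> z - z' = 0 -> z = 0.
  move=> le_z' /subr0_eq zz'; apply: supn_eq0.
  move: le_z'; rewrite -zz' mulrA => le_z.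
  have rr1 : rho * rho < 1 by nra.
  by rewrite leNgt; apply/negP => z0; move: le_z; rewrite leNgt gtr_pMl// rr1.
split; apply: unitmx_inj => z; rewrite mulmxBl mul1mx -mulmxA; apply: strict.
- by rewrite (le_trans (boundG _))// ler_wpM2l.
- by rewrite (le_trans (boundH _))// ler_wpM2l.
Qed.

Lemma scatters_mulmxr s p q (x x' : 'M[R[i]]_(n, p)) (y y' : 'M[R[i]]_(m, p))
    (T : 'M[R[i]]_(p, q)) :
  scatters s x x' y y' -> scatters s (x *m T) (x' *m T) (y *m T) (y' *m T).
Proof. by case=> -> ->; split; rewrite mulmxDl !mulmxA. Qed.

(** Doubling is composition: the two inverses in the recursion solve for the
    intermediate values [x'] and [y'] in terms of [x] and [y'']. *)
Lemma scatters_step s p (x x' x'' : 'M[R[i]]_(n, p))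
    (y y' y'' : 'M[R[i]]_(m, p)) :
  step_defined s -> scatters s x x' y y' -> scatters s x' x'' y' y'' ->
  scatters (adda_step s) x x'' y y''.
Proof.
case: s => E F G H []/= uGH uHG [/= eqx' ->] [/= -> eqy'].
have x'E : x' = invmx (1%:M - G *m H) *m (E *m x + G *m F *m y'').
  apply: (canRL (mulKmx uGH)).
  by rewrite mulmxBl mul1mx {1}eqx' eqy' mulmxDr !mulmxA addrA addrAC addrK.
have y'E : y' = invmx (1%:M - H *m G) *m (H *m E *m x + F *m y'').
  apply: (canRL (mulKmx uHG)).
  by rewrite mulmxBl mul1mx {1}eqy' eqx' mulmxDr !mulmxA addrAC addrK.
split=> /=.
- by rewrite {1}x'E !mulmxDr mulmxDl !mulmxA -addrA (addrC (G *m y'')).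
- by rewrite {1}y'E !mulmxDr mulmxDl !mulmxA addrA.
Qed.

Lemma adda_step_split s (x x'' : 'cV[R[i]]_n) (y y'' : 'cV[R[i]]_m) :
  step_defined s -> scatters (adda_step s) x x'' y y'' ->
  exists x' y', scatters s x x' y y' /\ scatters s x' x'' y' y''.
Proof.
move=> sd sc; case: (sd) => uGH _.
pose E := adda_E s; pose F := adda_F s; pose G := adda_G s; pose H := adda_H s.
pose x' := invmx (1%:M - G *m H) *m (E *m x + G *m F *m y'').
pose y' := H *m x' + F *m y''.
have x'E : x' = E *m x + G *m y'.
  have : (1%:M - G *m H) *m x' = E *m x + G *m F *m y'' by rewrite mulKVmx.
  rewrite mulmxBl mul1mx => /(canRL (subrK _)) ->.
  by rewrite /y' mulmxDr !mulmxA addrAC addrA.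
have s1 : scatters s x x' (H *m x + F *m y') y' by split.
have s2 : scatters s x' (E *m x' + G *m y'') y' y'' by split.
exists x', y'; have [eqx eqy] := scatters_step sd s1 s2.
by case: sc => -> ->; rewrite -eqx -eqy.
Qed.

(** For the intermediate values, [v] is their common size relative to the
    weight [a * b].  Both contraction bounds give [v <= rho * max u v], which
    forces [v <= u]; so the outer bounds are not worsened by the feedback
    between the two ports. *)
Lemma contractive_step rho a b s :
  0 <= rho < 1 -> 0 < a -> 0 < b -> contractive rho a b s ->
  contractive rho (a ^+ 2) (b ^+ 2) (adda_step s).
Proof.
move=> rho01 a0 b0 cs x x'' y y'' u sc xu y''u.
have [x' [y' [s1 s2]]] :=
  adda_step_split (contractive_step_defined rho01 a0 b0 cs) sc.
have u0 : 0 <= u.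
  by have := le_trans (supn_ge0 x) xu; rewrite pmulr_rge0// exprn_gt0.
have ab0 : 0 < a * b by exact: mulr_gt0.
pose v := Num.max (supn x') (supn y') / (a * b).
pose w := Num.max u v.
have vE : a * b * v = Num.max (supn x') (supn y').
  by rewrite mulrC divfK ?gt_eqF.
have v0 : 0 <= v by rewrite divr_ge0 ?(ltW ab0)// le_max supn_ge0.
have xw : supn x <= a * (a * w).
  by rewrite mulrA -expr2 (le_trans xu)// ler_pM2l ?exprn_gt0// le_max lexx.
have y''w : supn y'' <= b * (b * w).
  by rewrite mulrA -expr2 (le_trans y''u)// ler_pM2l ?exprn_gt0// le_max lexx.
have vw : a * b * v <= a * b * w by rewrite ler_pM2l// le_max lexx orbT.
have x'w : supn x' <= a * (b * w).
  by rewrite mulrA (le_trans _ vw)// vE le_max lexx.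
have y'w : supn y' <= b * (a * w).
  by rewrite mulrCA mulrA (le_trans _ vw)// vE le_max lexx orbT.
have [x'r yr] := cs _ _ _ _ _ s1 xw y'w.
have [x''r y'r] := cs _ _ _ _ _ s2 x'w y''w.
have vr : v <= rho * w.
  rewrite -(ler_pM2l ab0) vE ge_max; apply/andP; split.
    by rewrite (le_trans x'r)//; lra.
  by rewrite (le_trans y'r)//; lra.
have wu : w = u.
  rewrite /w; apply/max_idPl; case: (leP v u) => // uv.
  have wv : w = v by apply/max_idPr/ltW.
  have v1 : 0 < v by exact: le_lt_trans u0 uv.
  by move: vr; rewrite wv leNgt gtr_pMl//; case/andP: rho01 => _ ->.
rewrite -wu; split; [apply: le_trans x''r _|apply: le_trans yr _];
  by rewrite expr2 -mulrA.
Qed.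

Lemma contractive_adda A B C D alpha beta rho a b k :
  0 <= rho < 1 -> 0 < a -> 0 < b ->
  contractive rho a b (adda_init A B C D alpha beta) ->
  contractive rho (a ^+ (2 ^ k)) (b ^+ (2 ^ k)) (adda A B C D alpha beta k).
Proof.
move=> rho01 a0 b0 c0; elim: k => [|k IH]; first by rewrite expn0 !expr1.
rewrite expnSr !exprM; apply: contractive_step => //; exact: exprn_gt0.
Qed.

End Doubling.

Section DoublingGraph.
Variables (R : realType) (m n : nat).
Variables (A : 'M[R[i]]_m.+1) (B : 'M[R[i]]_(m.+1, n.+1)).
Variables (C : 'M[R[i]]_(n.+1, m.+1)) (D : 'M[R[i]]_n.+1) (alpha beta : R[i]).
Local Notation state k := (adda A B C D alpha beta k).
Hypothesis defined : forall k, step_defined (state k).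

(** If the first step maps the graph [(x, Phi x)] to itself through [T], stage
    [k] maps it to itself through [T ^+ (2 ^ k)]. *)
Lemma adda_scatters_graph (Phi : 'M[R[i]]_(m.+1, n.+1)) (T : 'M[R[i]]_n.+1) k :
  scatters (state 0) 1%:M T Phi (Phi *m T) ->
  scatters (state k) 1%:M (T ^+ (2 ^ k)) Phi (Phi *m T ^+ (2 ^ k)).
Proof.
move=> s0; elim: k => [|k IH]; first by rewrite expn0 expr1.
apply: (scatters_step (defined k) IH _).
have := scatters_mulmxr (T ^+ (2 ^ k)) IH.
by rewrite mul1mx expnSr exprM expr2 -mulmxA.
Qed.

(** The same for the graph [(Psi y, y)], on which the evolution runs
    backwards, from [y'] to [y]. *)
Lemma adda_scatters_cograph (Psi : 'M[R[i]]_(n.+1, m.+1))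
    (T : 'M[R[i]]_m.+1) k :
  scatters (state 0) (Psi *m T) Psi T 1%:M ->
  scatters (state k) (Psi *m T ^+ (2 ^ k)) Psi (T ^+ (2 ^ k)) 1%:M.
Proof.
move=> s0; elim: k => [|k IH]; first by rewrite expn0 expr1.
apply: (scatters_step (defined k) _ IH).
have := scatters_mulmxr (T ^+ (2 ^ k)) IH.
by rewrite mul1mx expnSr exprM expr2 -mulmxA.
Qed.

End DoublingGraph.

(** * The initial matrices solve the implicit equations *)

Section Initial.
Variables (R : realType) (m n : nat) (A : 'M[R[i]]_m) (B : 'M[R[i]]_(m, n))
  (C : 'M[R[i]]_(n, m)) (D : 'M[R[i]]_n) (alpha beta : R[i]).
Local Notation Ab := (adda_A A beta).
Local Notation Da := (adda_D D alpha).
Local Notation W := (adda_W A B C D alpha beta).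
Local Notation V := (adda_V A B C D alpha beta).
Local Notation init := (adda_init A B C D alpha beta).
Hypotheses (uA : Ab \in unitmx) (uD : Da \in unitmx) (uW : W \in unitmx).

(* The lower left block, up to sign, of the inverse of [[Da, C; B, Ab]]. *)
Let X := invmx W *m B *m invmx Da.

Lemma mulB_invD_C : B *m invmx Da *m C = Ab - W.
Proof. by rewrite /adda_W opprB addrC subrK. Qed.

Lemma mulB_schur_inv : B *m (invmx Da + invmx Da *m C *m X) = Ab *m X.
Proof.
have -> : B *m (invmx Da + invmx Da *m C *m X)
    = B *m invmx Da + B *m invmx Da *m C *m X by rewrite mulmxDr !mulmxA.
have WX : W *m X = B *m invmx Da by rewrite /X -mulmxA mulKVmx.
by rewrite mulB_invD_C mulmxBl WX addrC subrK.
Qed.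

Lemma mulD_schur_inv : Da *m (invmx Da + invmx Da *m C *m X) = 1%:M + C *m X.
Proof. by rewrite mulmxDr mulmxV// -(mulmxA (invmx Da)) mulKVmx. Qed.

Lemma mulV_schur_inv : V *m (invmx Da + invmx Da *m C *m X) = 1%:M.
Proof.
rewrite /adda_V mulmxBl mulD_schur_inv -(mulmxA (C *m _)) mulB_schur_inv.
by rewrite -(mulmxA C) mulKmx// addrK.
Qed.

Lemma unitmx_schur : V \in unitmx.
Proof. by case/mulmx1_unit: mulV_schur_inv. Qed.

(** The Woodbury formula: the inverse of one Schur complement through that of
    the other. *)
Lemma invmx_schur : invmx V = invmx Da + invmx Da *m C *m X.
Proof. by rewrite -[RHS](mulKmx unitmx_schur) mulV_schur_inv mulmx1. Qed.

(** Since [A - alpha = Ab - (alpha + beta)] and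
    [D - beta = Da - (alpha + beta)], only the shifted blocks and the scalar
    [alpha + beta] remain, as in the initial matrices. *)
Lemma cayley_relationE p (x x' : 'M[R[i]]_(n, p)) (y y' : 'M[R[i]]_(m, p)) :
  cayley_relation A B C D alpha beta x x' y y' <->
  Da *m x' + C *m y = Da *m x - (alpha + beta) *: x + C *m y' /\
  B *m x' + Ab *m y = B *m x + (Ab *m y' - (alpha + beta) *: y').
Proof.
have -> : Da *m x - (alpha + beta) *: x = (D - beta%:M) *m x.
  rewrite /adda_D mulmxDl mulmxBl !mul_scalar_mx scalerDl opprD addrA.
  by rewrite addrK.
have -> : Ab *m y' - (alpha + beta) *: y' = (A - alpha%:M) *m y'.
  rewrite /adda_A mulmxDl mulmxBl !mul_scalar_mx (addrC alpha) scalerDl opprD addrA.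
  by rewrite addrK.
by [].
Qed.

Lemma scatters_init_cayley p (x x' : 'M[R[i]]_(n, p)) (y y' : 'M[R[i]]_(m, p)) :
  scatters init x x' y y' -> cayley_relation A B C D alpha beta x x' y y'.
Proof.
case=> /= eqx' eqy; apply/cayley_relationE.
set k := alpha + beta in eqx' eqy *.
pose P := X *m x; pose Q := invmx W *m y'.
have {}eqx' : x' = x - k *: (invmx V *m x) + k *: (invmx Da *m C *m Q).
  by rewrite eqx' mulmxBl mul1mx -!scalemxAl /Q !mulmxA.
have {}eqy : y = k *: P + (y' - k *: Q).
  by rewrite eqy mulmxBl mul1mx -!scalemxAl /P /Q /X.
have DV : Da *m (invmx V *m x) = x + C *m P.
  by rewrite invmx_schur mulmxA mulD_schur_inv mulmxDl mul1mx -mulmxA.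
have BV : B *m (invmx V *m x) = Ab *m P.
  by rewrite invmx_schur mulmxA mulB_schur_inv -mulmxA.
have DQ : Da *m (invmx Da *m C *m Q) = C *m Q by rewrite -mulmxA mulKVmx.
have BQ : B *m (invmx Da *m C *m Q) = Ab *m Q - y'.
  by rewrite !(mulmxA B) mulB_invD_C mulmxBl {2}/Q mulKVmx.
rewrite eqx' eqy !mulmxDr !mulmxN -!scalemxAr DV BV DQ BQ.
(* Only the additive structure matters now, so [ring] settles each entry. *)
move: (Da *m x) (C *m P) (C *m Q) (C *m y').
move: (B *m x) (Ab *m P) (Ab *m Q) (Ab *m y').
move=> M1 M2 M3 M4 M5 M6 M7 M8.
by split; apply/matrixP => i j; rewrite !mxE; ring.
Qed.

(** The converse holds because the system is uniquely solvable in [x'] and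
    [y]: eliminating [x'] leaves the Schur complement [W], a unit. *)
Lemma cayley_scatters_init p (x x' : 'M[R[i]]_(n, p)) (y y' : 'M[R[i]]_(m, p)) :
  cayley_relation A B C D alpha beta x x' y y' -> scatters init x x' y y'.
Proof.
pose x1 := adda_E init *m x + adda_G init *m y'.
pose y1 := adda_H init *m x + adda_F init *m y'.
have [] : cayley_relation A B C D alpha beta x x1 y1 y'.
  exact: scatters_init_cayley.
move=> e1 e2 [f1 f2].
have g1 : Da *m (x' - x1) + C *m (y - y1) = 0.
  by rewrite !mulmxBr addrACA -opprD f1 e1 subrr.
have g2 : B *m (x' - x1) + Ab *m (y - y1) = 0.
  by rewrite !mulmxBr addrACA -opprD f2 e2 subrr.
have xy : x' - x1 = - (invmx Da *m C *m (y - y1)).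
  rewrite -mulmxA -mulmxN; apply: (canRL (mulKmx uD)).
  by apply/eqP; rewrite -addr_eq0 g1.
have yy : y - y1 = 0.
  have Wz : W *m (y - y1) = 0.
    by rewrite /adda_W mulmxBl addrC -!(mulmxA B) -mulmxN -xy g2.
  by rewrite -(mulKmx uW (y - y1)) Wz mulmx0.
by split; apply/eqP; rewrite -subr_eq0 ?yy// xy yy mulmx0 oppr0.
Qed.

End Initial.

Section Units.
Variables (R : realType) (m n : nat) (A : 'M[R[i]]_m) (B : 'M[R[i]]_(m, n))
  (C : 'M[R[i]]_(n, m)) (D : 'M[R[i]]_n) (alpha beta : R[i]) (delta : R).
Hypotheses (gapD : row_gap D C alpha beta delta).
Hypotheses (gapA : row_gap A B beta alpha delta).
Hypotheses (d0 : 0 < delta) (a0 : 0 < cmod alpha) (b0 : 0 < cmod beta).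

Lemma row_gap0 p q (D' : 'M[R[i]]_p) (C' : 'M[R[i]]_(p, q)) a b :
  row_gap D' C' a b delta -> row_gap D' (0 : 'M[R[i]]_(p, q)) a b delta.
Proof.
move=> gap i; have [g1 g2] := gap i.
have c0 : 0 <= \sum_j cmod (C' i j) by apply: sumr_ge0 => j _; exact: cmod_ge0.
by rewrite (eq_bigr (fun=> 0)) ?big1_eq => [|j _]; rewrite ?mxE ?cmod0//; split; lra.
Qed.

(** A contraction sends zero inputs to zero outputs. *)
Lemma cayley_unique0 (A' : 'M[R[i]]_m) (B' : 'M[R[i]]_(m, n))
    (C' : 'M[R[i]]_(n, m)) (D' : 'M[R[i]]_n)
    (x' : 'cV[R[i]]_n) (y : 'cV[R[i]]_m) :
  row_gap D' C' alpha beta delta -> row_gap A' B' beta alpha delta ->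
  (D' + alpha%:M) *m x' + C' *m y = 0 -> B' *m x' + (A' + beta%:M) *m y = 0 ->
  x' = 0 /\ y = 0.
Proof.
move=> gD gA e1 e2.
have rel : cayley_relation A' B' C' D' alpha beta 0 x' y 0.
  by split; rewrite ?e1 ?e2 !mulmx0 addr0.
have := cayley_contraction (u := 0) gD gA d0 a0 b0 rel.
by rewrite !supn0 !mulr0 => -[] // /supn_eq0 -> /supn_eq0 ->.
Qed.

(** The coupling blocks [B] and [C] may be replaced by [0] without losing
    [row_gap]; this isolates the two diagonal blocks. *)
Lemma unitmx_adda_D : adda_D D alpha \in unitmx.
Proof.
apply: unitmx_inj => z Dz.
have [] // := @cayley_unique0 A 0 C D z 0 gapD (row_gap0 gapA).
  by rewrite mulmx0 addr0.
by rewrite mul0mx mulmx0 addr0.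
Qed.

Lemma unitmx_adda_A : adda_A A beta \in unitmx.
Proof.
apply: unitmx_inj => z Az.
have [] // := @cayley_unique0 A B 0 D 0 z (row_gap0 gapD) gapA.
  by rewrite mulmx0 mul0mx addr0.
by rewrite mulmx0 add0r.
Qed.

Lemma unitmx_adda_W : adda_W A B C D alpha beta \in unitmx.
Proof.
have uD := unitmx_adda_D; apply: unitmx_inj => z Wz.
have [] // := @cayley_unique0 A B C D
    (- (invmx (adda_D D alpha) *m (C *m z))) z gapD gapA.
  by rewrite mulmxN mulKVmx// addNr.
by rewrite mulmxN addrC !mulmxA -mulmxBl.
Qed.

Lemma contractive_init :
  contractive (rate alpha beta delta) (cmod alpha) (cmod beta)
    (adda_init A B C D alpha beta).
Proof.
move=> x x' y y' u.
move=> /(scatters_init_cayley unitmx_adda_A unitmx_adda_D unitmx_adda_W).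
exact: cayley_contraction.
Qed.

Lemma well_defined_adda : adda_well_defined A B C D alpha beta.
Proof.
have uA := unitmx_adda_A; have uD := unitmx_adda_D; have uW := unitmx_adda_W.
split=> // [|k]; first exact: unitmx_schur.
have r01 := rate_bounds a0 b0 d0.
have := contractive_adda (k := k) r01 a0 b0 contractive_init.
by apply: contractive_step_defined => //; exact: exprn_gt0.
Qed.

End Units.

(** * Powers of a matrix with spectrum in the unit disc *)

Section PowerDecay.
Variables (R : realType) (n : nat) (T : 'M[R[i]]_n.+1).

(** Induction on the factors of the annihilating polynomial.  The vector
    [(T - l) x] is annihilated by one factor less, so it decays, and
    [T^(k+1) x = l T^k x + T^k (T - l) x] transfers the decay to [x], at any
    rate [s] larger than both [cmod l] and the rate already obtained. *)
Lemma geometric_decay_annihilated (ls : seq R[i]) :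
  (forall l, l \in ls -> cmod l < 1) ->
  forall x : 'cV[R[i]]_n.+1,
  horner_mx T (\prod_(l <- ls) ('X - l%:P)) *m x = 0 ->
  exists K r, [/\ 0 <= K, 0 <= r < 1
    & forall k, supn (T ^+ k *m x) <= K * r ^+ k].
Proof.
elim: ls => [|l ls IH] ls1 x.
  rewrite big_nil rmorph1 mul1mx => ->; exists 0, 0.
  split=> // [|k]; first by rewrite lexx ltr01.
  by rewrite mulmx0 supn0 mul0r.
rewrite big_cons mulrC rmorphM /= -mulmxE -mulmxA.
move=> /IH[l' l'ls|K [r [K0 /andP[r0 r1] Kr]]].
  by apply: ls1; rewrite inE l'ls orbT.
have l1 : cmod l < 1 by apply: ls1; rewrite inE eqxx.
have l0 : 0 <= cmod l := cmod_ge0 l.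
pose s := (1 + Num.max r (cmod l)) / 2.
have [rm lm] : r <= Num.max r (cmod l) /\ cmod l <= Num.max r (cmod l).
  by rewrite !le_max !lexx orbT.
have m1 : Num.max r (cmod l) < 1 by rewrite gt_max r1.
have [rs ls' s1] : [/\ r <= s, cmod l < s & s < 1] by rewrite /s; split; lra.
have s0 : 0 < s by lra.
(* With this [K'], both the case [k = 0] and the step [K <= K' * (s - cmod l)]
   go through. *)
pose K' := supn x + K / (s - cmod l).
have K's : K <= K' * (s - cmod l).
  rewrite /K' mulrDl divfK; last by rewrite subr_eq0 gt_eqF.
  by rewrite lerDr mulr_ge0 ?supn_ge0// subr_ge0 ltW.
exists K', s; split; [|by rewrite s1 ltW|].
  by rewrite /K' addr_ge0 ?supn_ge0// divr_ge0// subr_ge0 ltW.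
elim=> [|k IHk].
  by rewrite !expr0 mul1mx mulr1 /K' lerDl divr_ge0// subr_ge0 ltW.
have -> : T ^+ k.+1 *m x =
    l *: (T ^+ k *m x) + T ^+ k *m (horner_mx T ('X - l%:P) *m x).
  rewrite rmorphB /= horner_mx_X horner_mx_C mulmxBl mul_scalar_mx mulmxBr.
  by rewrite -scalemxAr addrC subrK exprSr -mulmxE mulmxA.
apply: le_trans (supnD _ _) _.
have h1 := le_trans (supnZ _ _) (ler_wpM2l l0 IHk).
have h2 : K * r ^+ k <= K' * (s - cmod l) * s ^+ k.
  by apply: ler_pM => //; rewrite ?exprn_ge0// lerXn2r// ?nnegrE// ltW.
rewrite exprS; have := Kr k; lra.
Qed.

Lemma powers_cvg0 (x : 'cV[R[i]]_n.+1) (eps : R) :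
  (forall l, eigenvalue T l -> cmod l < 1) -> 0 < eps ->
  exists k, supn (T ^+ k *m x) < eps.
Proof.
move=> eig eps0.
have [ls chiE] := closed_field_poly_normal (char_poly T).
have {}chiE : char_poly T = \prod_(l <- ls) ('X - l%:P).
  by rewrite chiE (monicP (char_poly_monic T)) scale1r.
have [||K [r [K0 /andP[r0 r1] Kr]]] := @geometric_decay_annihilated ls _ x.
- by move=> l lls; apply: eig; rewrite eigenvalue_root_char chiE root_prod_XsubC.
- by rewrite -chiE Cayley_Hamilton mul0mx.
have /cvgrPdist_lt/(_ eps eps0)[N _ /(_ N (leqnn N))] :
    (geometric K r @ \oo --> (0 : R))%classic.
  by apply: cvg_geometric; rewrite ger0_norm.
rewrite sub0r normrN /geometric /= => lt_eps.
by exists N; rewrite (le_lt_trans (Kr N))// (le_lt_trans (ler_norm _)).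
Qed.

End PowerDecay.

(** * Extremal solutions as invariant graphs *)

Section Stable.
Variables (R : realType) (n : nat) (M : 'M[R[i]]_n.+1) (w tau : R).
Hypothesis stable : forall l, eigenvalue M l -> 0 < omega_part w l.
Hypotheses (tau0 : 0 < tau) (vp0 : 0 < varpi w).
Let alpha := real_complex R tau * z_bot w.

Definition cayley p (S : 'M[R[i]]_p) (a b : R[i]) : 'M[R[i]]_p :=
  invmx (S + a%:M) *m (S - b%:M).

Lemma real_complexM_bot (s : R) :
  real_complex R s * z_bot w = Complex (s * w) (s * (1 - w)).
Proof. by apply/eqP; rewrite eq_complex /= !mul0r subr0 addr0 !eqxx. Qed.

Lemma unitmx_shift_stable : M + alpha%:M \in unitmx.
Proof.
apply: contraT => nu.
have /stable : eigenvalue M (- alpha).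
  rewrite /eigenvalue /eigenspace raddfN opprK kermx_eq0.
  by rewrite row_free_unit.
rewrite /omega_part /alpha real_complexM_bot /=.
have := mulr_gt0 tau0 vp0; rewrite /varpi; lra.
Qed.

(** The eigenvalue [l] of the transform comes from the eigenvalue
    [lam = alpha (1 + l) / (1 - l)] of [M], and
    [omega_part w lam * |1 - l|^2 = tau * varpi w * (1 - |l|^2)]: the
    half-plane of the spectral condition corresponds to the unit disc. *)
Lemma cayley_eigenvalue l : eigenvalue (cayley M alpha alpha) l -> cmod l < 1.
Proof.
have uM := unitmx_shift_stable.
case/eigenvalueP => v vT v0.
pose z := v *m invmx (M + alpha%:M).
have vE : v = z *m (M + alpha%:M) by rewrite /z mulmxKV.
have z0 : z != 0 by apply: contra_neq v0 => z0; rewrite vE z0 mul0mx.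
have eqz : (1 - l) *: (z *m M) = ((1 + l) * alpha) *: z.
  have : z *m (M - alpha%:M) = l *: (z *m (M + alpha%:M)).
    by rewrite -vE -vT /cayley mulmxA.
  rewrite !mulmxDr mulmxN !mul_mx_scalar scalerDr scalerA.
  move=> /(canRL (subrK _)) eqz.
  rewrite scalerBl scale1r; apply/eqP; rewrite subr_eq; apply/eqP.
  rewrite {1}eqz mulrDl mul1r scalerDl -addrA addrC.
  by rewrite (addrC ((l * alpha) *: z)).
have l1 : 1 - l != 0.
  apply/eqP => l1; move: eqz; rewrite l1 scale0r => /esym/eqP.
  have -> : l = 1 by apply/eqP; rewrite eq_sym -subr_eq0 l1.
  rewrite scaler_eq0 (negPf z0) orbF mulf_eq0 /alpha real_complexM_bot => /orP[|].
    by rewrite -mulr2n pnatr_eq0.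
  rewrite eq_complex /= => /andP[/eqP tw /eqP t1w].
  have := mulr_gt0 tau0 (mulr_gt0 tau0 vp0).
  rewrite /varpi.
  have -> : tau * (tau * (w ^+ 2 + (1 - w) ^+ 2)) =
    (tau * w) ^+ 2 + (tau * (1 - w)) ^+ 2 by ring.
  by rewrite tw t1w expr0n addr0 ltxx.
pose lam := (1 + l) * alpha / (1 - l).
have /stable : eigenvalue M lam.
  apply/eigenvalueP; exists z => //.
  by apply: (scalerI l1); rewrite eqz scalerA /lam (mulrC (1 - l)) divfK.
have : lam * (1 - l) = (1 + l) * alpha by rewrite /lam divfK.
rewrite /alpha real_complexM_bot; case: lam => c d; case: l l1 {vT eqz} => x y l1.
rewrite -[1]/(Complex 1 0); simpc => -[eq1 eq2].
rewrite /omega_part /= => pos.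
have nz : 0 < (1 - x) ^+ 2 + y ^+ 2.
  rewrite lt_def addr_ge0 ?sqr_ge0// andbT paddr_eq0 ?sqr_ge0// !sqrf_eq0.
  apply: contra l1 => /andP[/eqP x1 /eqP y0].
  by rewrite y0 eq_complex /= x1 subr0 !eqxx.
have key : (w * c + (1 - w) * d) * ((1 - x) ^+ 2 + y ^+ 2) =
    tau * varpi w * (1 - (x ^+ 2 + y ^+ 2)).
  have e1 : c * (1 - x) + d * y = tau * ((1 + x) * w - y * (1 - w)) by lra.
  have e2 : d * (1 - x) - c * y = tau * ((1 + x) * (1 - w) + y * w) by lra.
  (* [lam] is [(lam * (1 - l)) * (1 - l)^*] divided by [|1 - l|^2]. *)
  transitivity (
    w * ((1 - x) * (c * (1 - x) + d * y) - y * (d * (1 - x) - c * y)) +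
    (1 - w) * (y * (c * (1 - x) + d * y) + (1 - x) * (d * (1 - x) - c * y))).
    by ring.
  by rewrite e1 e2 /varpi; ring.
have : 0 < tau * varpi w * (1 - (x ^+ 2 + y ^+ 2)) by rewrite -key mulr_gt0.
rewrite pmulr_rgt0 ?mulr_gt0// subr_gt0 => xy1.
by rewrite cmodE -sqrtr1 ltr_sqrt.
Qed.

End Stable.

Section Graph.
Variables (R : realType) (m n : nat).
Variables (A : 'M[R[i]]_m.+1) (B : 'M[R[i]]_(m.+1, n.+1)).
Variables (C : 'M[R[i]]_(n.+1, m.+1)) (D : 'M[R[i]]_n.+1).
Variable Phi : 'M[R[i]]_(m.+1, n.+1).
Hypothesis riccati : Phi *m C *m Phi - Phi *m D - A *m Phi + B = 0.
Local Notation M := (D - C *m Phi).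

(** The Riccati equation says that the graph of [Phi] is invariant under
    [[D, -C; B, -A]], which acts on it as [M]; the Cayley transform then acts
    on it as that of [M]. *)
Lemma graph_cayley_relation alpha beta : M + alpha%:M \in unitmx ->
  cayley_relation A B C D alpha beta 1%:M (cayley M alpha beta)
    Phi (Phi *m cayley M alpha beta).
Proof.
move=> uM; pose T := cayley M alpha beta.
have MT : (M + alpha%:M) *m T = M - beta%:M by rewrite mulKVmx.
have AP : A *m Phi = Phi *m C *m Phi - Phi *m D + B.
  apply/eqP; rewrite -subr_eq0 -oppr_eq0 opprB; apply/eqP; rewrite -[RHS]riccati.
  by rewrite addrAC.
rewrite -/T; split.
  rewrite mulmx1 mulmxA; apply/eqP; rewrite -subr_eq; apply/eqP.
  have : D *m T + alpha *: T = M - beta%:M + C *m Phi *m T.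
    by rewrite -MT !mulmxDl mulNmx mul_scalar_mx addrAC subrK.
  rewrite mulmxDl mul_scalar_mx => ->.
  by rewrite addrAC addrK addrAC subrK.
have PMT : Phi *m M *m T + alpha *: (Phi *m T) = Phi *m M - beta *: Phi.
  have := congr1 (mulmx Phi) MT.
  rewrite mulmxDl mulmxDr mulmxBr mul_scalar_mx mul_mx_scalar.
  by rewrite -scalemxAr mulmxA.
have PM : Phi *m M = B - A *m Phi.
  by rewrite AP mulmxBr mulmxA opprD addrCA subrr addr0 opprB.
move: PMT; rewrite PM mulmxBl -!mulmxA.
rewrite mulmxDl mulmxBl !mul_scalar_mx mulmx1.
move: (Phi *m T) (B *m T) (A *m (Phi *m T)) (A *m Phi) => M3 M1 M2 M4 e.
apply/matrixP => i j; move/matrixP/(_ i j): e; rewrite !mxE => e.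
have -> : B i j =
    (M1 i j - M2 i j + alpha * M3 i j) + M4 i j + beta * Phi i j.
  by rewrite e; ring.
by ring.
Qed.

Variable delta : R.
Hypothesis d0 : 0 < delta.

(** Along an orbit [X k = T^k x] with [Y k = Phi X k], the contraction bounds
    [X k.+1] and [Y k] by the inputs [X k] and [Y k.+1].  Once [Y] dominates
    [X], the larger input must be [Y k.+1], so [Y] keeps dominating and never
    shrinks, against [X k] tending to [0]. *)
Lemma graph_nonexpansive tau :
  0 < cmod tau -> row_gap D C tau tau delta -> row_gap A B tau tau delta ->
  M + tau%:M \in unitmx ->
  (forall l, eigenvalue (cayley M tau tau) l -> cmod l < 1) ->
  forall x : 'cV[R[i]]_n.+1, supn (Phi *m x) <= supn x.
Proof.
move=> t0 gapD gapA uM eig x; rewrite leNgt; apply/negP => xP.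
pose T := cayley M tau tau; pose X k := T ^+ k *m x; pose Y k := Phi *m X k.
have [r0 r1] := andP (rate_bounds t0 t0 d0).
have rel k : cayley_relation A B C D tau tau (X k) (X k.+1) (Y k) (Y k.+1).
  have := cayley_relation_mulmxr (X k) (graph_cayley_relation tau uM).
  by rewrite -/T mul1mx -mulmxA /Y /X exprS -mulmxE !mulmxA.
have grow k : supn (X k) < supn (Y k) /\ supn (Phi *m x) <= supn (Y k).
  elim: k => [|k [XY PY]]; first by rewrite /Y /X expr0 mul1mx.
  pose u := Num.max (supn (X k)) (supn (Y k.+1)).
  have := cayley_contraction (u := u / cmod tau) gapD gapA d0 t0 t0 (rel k).
  rewrite [cmod tau * _]mulrC divfK ?gt_eqF// => -[||X' Y'];
    try by rewrite /u le_max lexx ?orbT.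
  have u0 : 0 <= u by rewrite /u le_max supn_ge0.
  have Yu : supn (Y k) <= u by rewrite (le_trans Y')// ler_piMl// ltW.
  have uE : u = supn (Y k.+1).
    apply/max_idPr; rewrite leNgt; apply/negP => YX.
    by move: Yu; rewrite /u max_l ?(ltW YX)// leNgt XY.
  have u1 : 0 < u by rewrite (lt_le_trans _ Yu)// (le_lt_trans (supn_ge0 (X k))).
  split; rewrite -uE; last exact: le_trans PY Yu.
  by rewrite (le_lt_trans X')// gtr_pMl.
have [K K0 PK] := supn_mulmx Phi.
have P0 : 0 < supn (Phi *m x) by rewrite (le_lt_trans (supn_ge0 x)).
have [k] := powers_cvg0 x eig (divr_gt0 P0 (ltr_wpDl K0 ltr01)).
rewrite ltr_pdivlMr; last lra.
have [_ PY] := grow k; have := PK (X k); rewrite -/(Y k) -/(X k) => le1.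
have := supn_ge0 (X k); lra.
Qed.

(** In the contraction for [(x, T x, Phi x, Phi T x)] the input [Phi T x] is
    bounded by the output [T x], and absorbing it leaves the bound in terms of
    [x]. *)
Lemma graph_contraction alpha beta :
  0 < cmod alpha -> 0 < cmod beta ->
  row_gap D C alpha beta delta -> row_gap A B beta alpha delta ->
  M + alpha%:M \in unitmx ->
  (forall x : 'cV[R[i]]_n.+1, supn (Phi *m x) <= supn x) ->
  forall x : 'cV[R[i]]_n.+1, cmod alpha * supn (cayley M alpha beta *m x)
    <= rate alpha beta delta * cmod beta * supn x.
Proof.
move=> a0 b0 gapD gapA uM P1 x.
set T := cayley M alpha beta.
have [r0 r1] := andP (rate_bounds a0 b0 d0).
have rel : cayley_relation A B C D alpha beta
    x (T *m x) (Phi *m x) (Phi *m (T *m x)).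
  have := cayley_relation_mulmxr x (graph_cayley_relation beta uM).
  by rewrite mul1mx -mulmxA.
pose u := Num.max (supn x / cmod alpha) (supn (T *m x) / cmod beta).
have [] := cayley_contraction (u := u) gapD gapA d0 a0 b0 rel.
- by rewrite mulrC -ler_pdivrMr// /u le_max lexx.
- by rewrite (le_trans (P1 _))// mulrC -ler_pdivrMr// /u le_max lexx orbT.
(* If the maximum is the term of [T x], then [T x] is zero. *)
rewrite /u; case: (leP (supn x / _) _) => [_|_] Tx _; last first.
  have : cmod alpha * supn (T *m x) <= cmod alpha *
      (rate alpha beta delta * (cmod beta * (supn x / cmod alpha))).
    by rewrite ler_pM2l.
  have -> : cmod alpha *
      (rate alpha beta delta * (cmod beta * (supn x / cmod alpha))) =
    rate alpha beta delta * cmod beta * supn x * (cmod alpha / cmod alpha).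
    by ring.
  by rewrite divff ?mulr1 ?gt_eqF.
have Tx0 : supn (T *m x) <= 0.
  move: Tx; rewrite [cmod beta * _]mulrC divfK ?gt_eqF// => Tx.
  by rewrite leNgt; apply/negP => T0; move: Tx; rewrite leNgt gtr_pMl// r1.
have -> : supn (T *m x) = 0 by apply: le_anti; rewrite Tx0 supn_ge0.
rewrite mulr0; apply: mulr_ge0; last exact: supn_ge0.
by apply: mulr_ge0 => //; exact: ltW.
Qed.

End Graph.

Section Extremal.
Variable R : realType.

(** The equal parameters [z tau] give the second conclusion, which the third
    needs at the parameters [z t] and [z gamma]. *)
Lemma extremal_graph m n (A : 'M[R[i]]_m.+1) (B : 'M[R[i]]_(m.+1, n.+1))
    (C : 'M[R[i]]_(n.+1, m.+1)) (D : 'M[R[i]]_n.+1) Phi w (t gamma delta : R) :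
  let z s := real_complex R s * z_bot w in
  let tau := Num.max t gamma in
  0 < varpi w -> 0 < cmod (z_bot w) -> 0 < t -> 0 < gamma -> 0 < delta ->
  extremal_solution A B C D w Phi ->
  row_gap D C (z t) (z gamma) delta -> row_gap A B (z gamma) (z t) delta ->
  row_gap D C (z tau) (z tau) delta -> row_gap A B (z tau) (z tau) delta ->
  let T := cayley (D - C *m Phi) (z t) (z gamma) in
  [/\ cayley_relation A B C D (z t) (z gamma) 1%:M T Phi (Phi *m T),
      forall x : 'cV[R[i]]_n.+1, supn (Phi *m x) <= supn x &
      forall x : 'cV[R[i]]_n.+1, cmod (z t) * supn (T *m x) <=
        rate (z t) (z gamma) delta * cmod (z gamma) * supn x].
Proof.
move=> z tau vp0 z0 t0 g0 d0 [ric stab] gD gA gDt gAt T.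
have tau0 : 0 < tau by rewrite lt_max t0.
have zpos s : 0 < s -> 0 < cmod (z s).
  move=> s0; rewrite cmodM mulr_gt0// lt_def cmod_ge0 andbT.
  apply/eqP => /cmod0_eq0/eqP; rewrite eq_complex /= eqxx andbT => /eqP s0'.
  by rewrite s0' ltxx in s0.
have uM := unitmx_shift_stable stab t0 vp0.
have uMt := unitmx_shift_stable stab tau0 vp0.
have eig := cayley_eigenvalue stab tau0 vp0.
have P1 := graph_nonexpansive ric d0 (zpos _ tau0) gDt gAt uMt eig.
split=> //; first exact: graph_cayley_relation.
exact: (graph_contraction ric d0 (zpos _ t0) (zpos _ g0)).
Qed.

Lemma cayley_relation_sym m n p (A : 'M[R[i]]_m) (B : 'M[R[i]]_(m, n))
    (C : 'M[R[i]]_(n, m)) (D : 'M[R[i]]_n) (alpha beta : R[i])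
    (x x' : 'M[R[i]]_(n, p)) (y y' : 'M[R[i]]_(m, p)) :
  cayley_relation D C B A beta alpha y' y x' x ->
  cayley_relation A B C D alpha beta x x' y y'.
Proof.
by case=> e1 e2; split; [rewrite addrC e2 addrC|rewrite addrC e1 addrC].
Qed.

End Extremal.

(** * The rate of convergence *)

Section Rate.
Variable R : realType.

Lemma supn_mulmx_exp n (T : 'M[R[i]]_n.+1) (a c : R) : 0 <= a -> 0 <= c ->
  (forall x : 'cV[R[i]]_n.+1, a * supn (T *m x) <= c * supn x) ->
  forall N (x : 'cV[R[i]]_n.+1),
    a ^+ N * supn (T ^+ N *m x) <= c ^+ N * supn x.
Proof.
move=> a0 c0 Tc; elim=> [|N IH] x; first by rewrite !expr0 !mul1mx.
rewrite [T ^+ _]exprS -mulmxE -mulmxA exprSr -mulrA.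
apply: (le_trans (ler_wpM2l (exprn_ge0 _ a0) (Tc _))).
by rewrite mulrCA exprS -mulrA ler_wpM2l.
Qed.

Lemma doubling_quadratic_cvg_bound m n (X : nat -> 'M[R[i]]_(m, n)) L rho :
  0 <= rho < 1 -> (forall k i j, cmod ((X k - L) i j) <= rho ^+ (2 ^ k)) ->
  doubling_quadratic_cvg X L.
Proof.
move=> /andP[r0 r1] Xr; rewrite /doubling_quadratic_cvg.
apply: (@le_lt_trans _ _ rho%:E); last by rewrite lte_fin.
apply: ge_ereal_inf; exists (ereal_sup (range
    (fun k => (complex.Re (mx_norm (X k - L)) `^ (2 ^- k))%:E))).
  by exists setT => //; exact: filterT.
apply: ge_ereal_sup => _ [k _ <-]; rewrite lee_fin.
have norm_le : complex.Re (mx_norm (X k - L)) <= rho ^+ (2 ^ k).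
  have [->|/mx_norm_neq0[i ->]] := eqVneq (mx_norm (X k - L)) 0.
    exact: exprn_ge0.
  exact: Xr.
have norm_ge0 : 0 <= complex.Re (mx_norm (X k - L)).
  have [->|/mx_norm_neq0[i ->]] := eqVneq (mx_norm (X k - L)) 0 => //.
  exact: cmod_ge0.
have root0 : 0 <= (2 ^- k : R) by rewrite invr_ge0 exprn_ge0.
apply: le_trans (ge0_ler_powR root0 _ _ norm_le) _; rewrite ?nnegrE ?exprn_ge0//.
rewrite -powR_mulrn// -powRrM natrX mulfV ?powRr1//.
Qed.

Lemma contractive_EF m n (s : adda_state R m n) rho a b :
  0 < a -> 0 < b -> contractive rho a b s ->
  (forall x : 'cV[R[i]]_n, a * supn (adda_E s *m x) <= rho * (b * supn x)) /\
  (forall y : 'cV[R[i]]_m, b * supn (adda_F s *m y) <= rho * (a * supn y)).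
Proof.
move=> a0 b0 cs; split=> z.
- have [] := cs z (adda_E s *m z) (adda_H s *m z) 0 (supn z / a).
  + by rewrite /scatters !mulmx0 !addr0.
  + by rewrite mulrC divfK ?gt_eqF.
  + by rewrite supn0 mulr_ge0 ?divr_ge0 ?supn_ge0// ltW.
  move=> le_z _; rewrite mulrC -ler_pdivlMr//.
  by rewrite (le_trans le_z)// -!mulrA.
- have [] := cs 0 (adda_G s *m z) (adda_F s *m z) z (supn z / b).
  + by rewrite /scatters !mulmx0 !add0r.
  + by rewrite supn0 mulr_ge0 ?divr_ge0 ?supn_ge0// ltW.
  + by rewrite mulrC divfK ?gt_eqF.
  move=> _ le_z; rewrite mulrC -ler_pdivlMr//.
  by rewrite (le_trans le_z)// -!mulrA.
Qed.

(** The factors [(a / b) ^+ N] of [F] and [(b / a) ^+ N] of [T ^+ N] cancel;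
    this is why the error decays for any ratio of the two parameters. *)
Lemma graph_error_bound p q (M : 'M[R[i]]_(p.+1, q.+1)) (F : 'M[R[i]]_p.+1)
    (T : 'M[R[i]]_q.+1) (a b rho : R) N :
  0 < a -> 0 < b -> 0 <= rho < 1 ->
  (forall y : 'cV[R[i]]_p.+1,
    b ^+ N * supn (F *m y) <= rho * (a ^+ N * supn y)) ->
  (forall x : 'cV[R[i]]_q.+1, supn (M *m x) <= supn x) ->
  (forall x : 'cV[R[i]]_q.+1, a * supn (T *m x) <= rho * b * supn x) ->
  forall i j, cmod ((F *m (M *m T ^+ N)) i j) <= rho ^+ N.
Proof.
move=> a0 b0 /andP[r0 r1] Fb Mb Tb i j.
pose e : 'cV[R[i]]_q.+1 := delta_mx j 0.
have e1 : supn e <= 1.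
  apply: supn_le => // k; rewrite mxE eqxx andbT.
  by case: (k == j) => /=; rewrite ?cmod0 ?ler01// /cmod normr1.
have -> : (F *m (M *m T ^+ N)) i j = (F *m (M *m (T ^+ N *m e))) i 0.
  by rewrite !mulmxA /e -colE [RHS]mxE.
apply: le_trans (cmod_le_supn _ _) _.
have bN : 0 < b ^+ N by exact: exprn_gt0.
rewrite -(ler_pM2l bN); apply: le_trans (Fb _) _.
have h1 : a ^+ N * supn (M *m (T ^+ N *m e)) <= a ^+ N * supn (T ^+ N *m e).
  by rewrite ler_wpM2l// exprn_ge0// ltW.
have h2 := supn_mulmx_exp (ltW a0) (mulr_ge0 r0 (ltW b0)) Tb N e.
have h3 : (rho * b) ^+ N * supn e <= (rho * b) ^+ N.
  by rewrite ler_piMr// exprn_ge0// mulr_ge0// ltW.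
have h4 := le_trans (le_trans h1 h2) h3.
rewrite exprMn (mulrC (rho ^+ N)) in h4.
have p0 : 0 <= b ^+ N * rho ^+ N by rewrite mulr_ge0 ?exprn_ge0// ltW.
apply: le_trans (ler_wpM2l r0 h4) _.
by rewrite ler_piMl// ltW.
Qed.

End Rate.

(** * From the bounds on the parameters to the row conditions *)

Section Gap.
Variables (R : realType) (w : R).
Hypothesis w01 : 0 <= w <= 1.
Local Notation r := (cmod (z_bot w)).

Lemma varpi_gt0 : 0 < varpi w.
Proof. by rewrite /varpi; nra. Qed.

Lemma cmod_z_botE : r ^+ 2 = varpi w.
Proof. by rewrite cmodE sqr_sqrtr// ltW// varpi_gt0. Qed.

Lemma cmod_z_bot_gt0 : 0 < r.
Proof. by rewrite cmodE sqrtr_gt0 varpi_gt0. Qed.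

Lemma cmod_z_bot_le1 : r <= 1.
Proof.
have w1 : w ^+ 2 + (1 - w) ^+ 2 <= 1 by case/andP: w01; nra.
by rewrite cmodE -[leRHS]sqrtr1; exact: ler_wsqrtr.
Qed.

(** With [omega_part], the real and imaginary parts of [d] times the conjugate
    of [z_bot w]. *)
Definition omega_perp (d : R[i]) : R :=
  w * complex.Im d - (1 - w) * complex.Re d.

Lemma cmod_rotate (d : R[i]) :
  (r * cmod d) ^+ 2 = omega_part w d ^+ 2 + omega_perp d ^+ 2.
Proof.
case: d => x y; rewrite exprMn cmod_z_botE cmodE sqr_sqrtr ?addr_ge0 ?sqr_ge0//.
by rewrite /varpi /omega_part /omega_perp /=; ring.
Qed.

Lemma cmod_real_bot (s : R) :
  0 <= s -> cmod (real_complex R s * z_bot w) = s * r.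
Proof.
move=> s0; rewrite cmodM; congr (_ * _).
by rewrite cmodE expr0n addr0 sqrtr_sqr ger0_norm.
Qed.

Lemma omega_partD (d : R[i]) (s : R) :
  omega_part w (d + real_complex R s * z_bot w)
    = omega_part w d + s * varpi w /\
  omega_perp (d + real_complex R s * z_bot w) = omega_perp d.
Proof.
rewrite real_complexM_bot; case: d => x y.
by rewrite /omega_part /omega_perp /varpi /=; split; ring.
Qed.

(** After multiplication by the conjugate of [z_bot w] the modulus is at least
    the real part, and dividing by [r <= 1] only widens the gap. *)
Lemma shift_away (d : R[i]) (q s delta : R) :
  0 <= q -> 0 < delta -> q + delta <= omega_part w d -> 0 <= s ->
  cmod (real_complex R s * z_bot w) + delta + q
    <= cmod (d + real_complex R s * z_bot w).
Proof.
move=> q0 d0 qd s0; rewrite cmod_real_bot//.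
set N := cmod (d + _).
have rN : omega_part w d + s * r ^+ 2 <= r * N.
  rewrite cmod_z_botE; have [<- _] := omega_partD d s.
  rewrite -(@ler_pXn2r _ 2)// ?nnegrE ?mulr_ge0 ?cmod_ge0//.
    by rewrite cmod_rotate lerDl sqr_ge0.
  have [-> _] := omega_partD d s.
  by rewrite addr_ge0 ?mulr_ge0 ?(ltW varpi_gt0)//; lra.
have r0 := cmod_z_bot_gt0; have r1 := cmod_z_bot_le1.
have h : q + delta <= r * (N - s * r) by lra.
have h0 : 0 < N - s * r by rewrite -(pmulr_rgt0 _ r0); lra.
have : r * (N - s * r) <= N - s * r by rewrite ler_piMl// ltW.
lra.
Qed.

(** The bound on [t] is the condition for the disc of centre
    [a + i b] and radius [q] to lie in the disc of centre and radius
    [t * varpi w]: expanding [(a - t')^2 + b^2 <= (t' - q)^2] leaves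
    [a^2 - q^2 + b^2 <= 2 t' (a - q)]. *)
Lemma shift_toward (d : R[i]) (q t : R) :
  0 <= q -> q < omega_part w d ->
  (omega_part w d + q) / 2 + omega_perp d ^+ 2 / (2 * (omega_part w d - q))
    <= t * varpi w ->
  0 < t /\ cmod (d - real_complex R t * z_bot w) + q
    <= cmod (real_complex R t * z_bot w).
Proof.
move=> q0 qd; set a := omega_part w d in qd *; set b := omega_perp d => pt.
have vp0 := varpi_gt0.
have aq0 : 0 < 2 * (a - q) by lra.
have pt' : (a + q) * (a - q) + b ^+ 2 <= t * varpi w * (2 * (a - q)).
  rewrite -ler_pdivrMr//; apply: le_trans pt; rewrite mulrDl lerD2r.
  by rewrite le_eqVlt; apply/orP; left; apply/eqP; field; lra.
have tq : (a + q) / 2 <= t * varpi w.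
  apply: le_trans pt; rewrite lerDl divr_ge0 ?sqr_ge0// ltW//.
have t0 : 0 < t by rewrite -(pmulr_lgt0 _ vp0); lra.
split=> //; rewrite cmod_real_bot ?(ltW t0)//.
have -> : d - real_complex R t * z_bot w = d + real_complex R (- t) * z_bot w.
  by rewrite rmorphN mulNr.
set N := cmod (d + _).
have r0 := cmod_z_bot_gt0; have r1 := cmod_z_bot_le1.
have rN : r * N <= t * r ^+ 2 - q.
  rewrite -(@ler_pXn2r _ 2)// ?nnegrE ?mulr_ge0 ?cmod_ge0//.
    rewrite cmod_rotate; have [-> ->] := omega_partD d (- t).
    by rewrite cmod_z_botE -/a -/b; lra.
  by rewrite cmod_z_botE; lra.
rewrite -(ler_pM2l r0).
have : 0 <= q * (1 - r) by rewrite mulr_ge0//; lra.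
lra.
Qed.

Lemma exists_min_gt0 k (f : 'I_k -> R) : (forall i, 0 < f i) ->
  exists2 delta, 0 < delta & forall i, delta <= f i.
Proof.
move=> f0; exists (\big[Num.min/1]_i f i).
  by apply: lt_bigmin.
by move=> i; exact: bigmin_le.
Qed.

Lemma row_gap_shift n m (D : 'M[R[i]]_n) (C : 'M[R[i]]_(n, m)) (s t delta : R) :
  let q i := offdiag_sum D i + \sum_j cmod (C i j) in
  0 < delta -> (forall i, q i + delta <= omega_part w (D i i)) -> 0 <= s ->
  (forall i, (omega_part w (D i i) + q i) / 2 +
     omega_perp (D i i) ^+ 2 / (2 * (omega_part w (D i i) - q i))
     <= t * varpi w) ->
  row_gap D C (real_complex R s * z_bot w) (real_complex R t * z_bot w) delta.
Proof.
move=> q d0 qd s0 pt i /=.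
have q0 : 0 <= q i.
  by rewrite addr_ge0 ?offdiag_sum_ge0// sumr_ge0// => j _; exact: cmod_ge0.
split; first exact: shift_away (qd i) s0.
by case: (shift_toward q0 _ (pt i)) => //; have := qd i; lra.
Qed.

End Gap.

Section Blocks.
Variables (R : realType) (m n : nat) (A : 'M[R[i]]_m) (B : 'M[R[i]]_(m, n))
  (C : 'M[R[i]]_(n, m)) (D : 'M[R[i]]_n).
Local Notation Q := (riccati_Q A B C D).

Lemma offdiag_sum_lshift i :
  offdiag_sum Q (lshift m i) = offdiag_sum D i + \sum_j cmod (C i j).
Proof.
rewrite /offdiag_sum big_split_ord /=; congr (_ + _).
  by apply: eq_big => j; rewrite ?eq_lshift// block_mxEul.
by apply: eq_big => j; rewrite ?eq_rlshift// block_mxEur mxE cmodN.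
Qed.

Lemma offdiag_sum_rshift i :
  offdiag_sum Q (rshift n i) = offdiag_sum A i + \sum_j cmod (B i j).
Proof.
rewrite /offdiag_sum big_split_ord /= addrC; congr (_ + _).
  by apply: eq_big => j; rewrite ?eq_rshift// block_mxEdr.
by apply: eq_big => j; rewrite ?eq_lrshift// block_mxEdl mxE cmodN.
Qed.

End Blocks.

Lemma omega_comparison_row_sum (R : realType) k (Q : 'M[R[i]]_k) w i :
  (omega_comparison w Q *m const_mx 1) i (0 : 'I_1) =
  omega_part w (Q i i) - offdiag_sum Q i.
Proof.
rewrite mxE (bigD1 i)//= !mxE eqxx mulr1; congr (_ + _).
rewrite /offdiag_sum -sumrN; apply: eq_bigr => j ji.
by rewrite !mxE eq_sym (negPf ji) mulr1.
Qed.

Lemma ord_maximum_ge (R : realType) k (f : 'I_k.+1 -> R) i :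
  f i <= ord_maximum f.
Proof. exact: le_bigmax. Qed.

(** * Convergence of the doubling algorithm *)

Theorem theorem6p4 (R : realType) (m n : nat) (w : R)
    (A : 'M[R[i]]_m.+1) (B : 'M[R[i]]_(m.+1, n.+1))
    (C : 'M[R[i]]_(n.+1, m.+1)) (D : 'M[R[i]]_n.+1)
    (Phi : 'M[R[i]]_(m.+1, n.+1)) (Psi : 'M[R[i]]_(n.+1, m.+1)) (t gamma : R) :
  0 <= w <= 1 ->
  class_H A B C D w ->
  positive_cV (omega_comparison w (riccati_Q A B C D) *m const_mx 1) ->
  extremal_solution A B C D w Phi ->
  extremal_solution D C B A w Psi ->
  ord_maximum (fun i : 'I_m.+1 =>
    p_omega w (riccati_Q A B C D) (rshift n.+1 i) / varpi w) <= t ->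
  ord_maximum (fun i : 'I_n.+1 =>
    p_omega w (riccati_Q A B C D) (lshift m.+1 i) / varpi w) <= gamma ->
  let alpha := real_complex R t * z_bot w in
  let beta := real_complex R gamma * z_bot w in
  let s := adda A B C D alpha beta in
  [/\ adda_well_defined A B C D alpha beta,
      doubling_quadratic_cvg (fun k => adda_H (s k)) Phi &
      doubling_quadratic_cvg (fun k => adda_G (s k)) Psi].
Proof.
move=> w01 _ posQ extPhi extPsi t_ge gamma_ge alpha beta s.
have vp0 := varpi_gt0 w.
have rows i : 0 < omega_part w (riccati_Q A B C D i i)
    - offdiag_sum (riccati_Q A B C D) i.
  by rewrite -omega_comparison_row_sum.
have [delta d0 rows_delta] := exists_min_gt0 rows.
have rowD i :
    offdiag_sum D i + \sum_j cmod (C i j) + delta <= omega_part w (D i i).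
  have := rows_delta (lshift m.+1 i).
  by rewrite offdiag_sum_lshift block_mxEul; lra.
have rowA i :
    offdiag_sum A i + \sum_j cmod (B i j) + delta <= omega_part w (A i i).
  have := rows_delta (rshift n.+1 i).
  by rewrite offdiag_sum_rshift block_mxEdr; lra.
(* Monotonicity in [u] covers [t] itself and the common parameter [tau]. *)
have pA u : t <= u -> forall i,
    let q := offdiag_sum A i + \sum_j cmod (B i j) in
    (omega_part w (A i i) + q) / 2 +
    omega_perp w (A i i) ^+ 2 / (2 * (omega_part w (A i i) - q)) <= u * varpi w.
  move=> tu i /=; rewrite -ler_pdivrMr//.
  apply: le_trans tu; apply: le_trans t_ge.
  have := ord_maximum_ge
    (fun i => p_omega w (riccati_Q A B C D) (rshift n.+1 i) / varpi w) i.
  by rewrite /p_omega offdiag_sum_rshift block_mxEdr.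
have pD u : gamma <= u -> forall i,
    let q := offdiag_sum D i + \sum_j cmod (C i j) in
    (omega_part w (D i i) + q) / 2 +
    omega_perp w (D i i) ^+ 2 / (2 * (omega_part w (D i i) - q)) <= u * varpi w.
  move=> tu i /=; rewrite -ler_pdivrMr//.
  apply: le_trans tu; apply: le_trans gamma_ge.
  have := ord_maximum_ge
    (fun i => p_omega w (riccati_Q A B C D) (lshift m.+1 i) / varpi w) i.
  by rewrite /p_omega offdiag_sum_lshift block_mxEul.
have row0 p q (M : 'M[R[i]]_p) (N : 'M[R[i]]_(p, q)) i :
    0 <= offdiag_sum M i + \sum_j cmod (N i j).
  by rewrite addr_ge0 ?offdiag_sum_ge0// sumr_ge0// => j _; exact: cmod_ge0.
have t0 : 0 < t.
  have [|//] := shift_toward w01 (row0 _ _ A B ord0) _ (pA t (lexx t) ord0).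
  by have := rowA ord0; lra.
have g0 : 0 < gamma.
  have [|//] := shift_toward w01 (row0 _ _ D C ord0) _
    (pD gamma (lexx gamma) ord0).
  by have := rowD ord0; lra.
have gapD u v : 0 <= u -> gamma <= v ->
    row_gap D C (real_complex R u * z_bot w) (real_complex R v * z_bot w) delta.
  by move=> u0 gv; apply: (row_gap_shift w01 d0 rowD u0); exact: pD.
have gapA u v : 0 <= u -> t <= v ->
    row_gap A B (real_complex R u * z_bot w) (real_complex R v * z_bot w) delta.
  by move=> u0 tv; apply: (row_gap_shift w01 d0 rowA u0); exact: pA.
have z0 := cmod_z_bot_gt0 w.
have a0 : 0 < cmod alpha by rewrite /alpha cmod_real_bot ?mulr_gt0// ltW.
have b0 : 0 < cmod beta by rewrite /beta cmod_real_bot ?mulr_gt0// ltW.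
have gD : row_gap D C alpha beta delta := gapD _ _ (ltW t0) (lexx _).
have gA : row_gap A B beta alpha delta := gapA _ _ (ltW g0) (lexx _).
have tau0 : 0 <= Num.max t gamma by rewrite le_max ltW.
have [ttau gtau] : t <= Num.max t gamma /\ gamma <= Num.max t gamma.
  by rewrite !le_max !lexx orbT.
have rho01 := rate_bounds a0 b0 d0.
have wd := well_defined_adda gD gA d0 a0 b0.
have [uA uD uW uV steps] := wd.
have contr k := contractive_adda (k := k) rho01 a0 b0
  (contractive_init gD gA d0 a0 b0).
have EF k := contractive_EF (exprn_gt0 (2 ^ k) a0) (exprn_gt0 (2 ^ k) b0)
  (contr k).
split=> //.
- have [rel P1 Tb] := extremal_graph vp0 z0 t0 g0 d0 extPhi gD gA
    (gapD _ _ tau0 gtau) (gapA _ _ tau0 ttau).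
  apply: (doubling_quadratic_cvg_bound rho01) => k i j.
  have [_ PhiE] := adda_scatters_graph steps k
    (cayley_scatters_init uA uD uW rel).
  have [_ Fb] := EF k.
  have -> : adda_H (s k) - Phi = - (adda_F (s k) *m
      (Phi *m cayley (D - C *m Phi) alpha beta ^+ (2 ^ k))).
    by rewrite {1}PhiE mulmx1 opprD addrA subrr add0r.
  rewrite mxE cmodN.
  exact: (graph_error_bound a0 b0 rho01 Fb P1 Tb).
- rewrite maxC in tau0 ttau gtau.
  have [rel P1 Tb] := extremal_graph vp0 z0 g0 t0 d0 extPsi gA gD
    (gapA _ _ tau0 ttau) (gapD _ _ tau0 gtau).
  apply: (doubling_quadratic_cvg_bound rho01) => k i j.
  have [PsiE _] := adda_scatters_cograph steps k
    (cayley_scatters_init uA uD uW (cayley_relation_sym rel)).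
  have [Eb _] := EF k.
  have -> : adda_G (s k) - Psi = - (adda_E (s k) *m
      (Psi *m cayley (A - B *m Psi) beta alpha ^+ (2 ^ k))).
    by rewrite {1}PsiE mulmx1 opprD addrCA subrr addr0.
  rewrite mxE cmodN.
  have rateC : rate beta alpha delta = rate alpha beta delta.
    by rewrite /rate (addrC (cmod beta)).
  move: Tb; rewrite -/alpha -/beta rateC => Tb.
  exact: (graph_error_bound b0 a0 rho01 Eb P1 Tb).
Qed.
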